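(* Let $j\in\mathbb{N}_0$ and let $T$ be a quadtree configuration with $\mathrm{cap}(T) \ge 4^{-j}$. Then $T$ can be transformed by a sequence of moves into a quadtree configuration $T^*$ that has an empty $j$-pixel.
   Context: The unit square $[0,1]^2$ is recursively subdivided as a quadtree of unbounded depth: the root (layer $0$) is $[0,1]^2$, and every node (pixel) of layer $j$ is an axis-parallel square of side $2^{-j}$ whose four children are its four quadrants. A pixel of layer $j$ is a $j$-pixel. For $r\in\mathbb{N}_0$, an $r$-square is an axis-parallel square of side $2^{-r}$. A (quadtree) configuration $T$ assigns finitely many squares to pixels, each $j$-square to a $j$-pixel, at most one square per pixel, such that no pixel with an assigned square is a proper descendant of another pixel with an assigned square. A pixel $p$ contains a square if it is assigned to $p$ or to a descendant of $p$. A pixel with an assigned square is occupied. A non-occupied pixel is blocked if some ancestor is occupied, free otherwise; a free pixel is empty if it contains no square. The capacity $\mathrm{cap}(p)$ of a $j$-pixel $p$ is $0$ if $p$ is occupied or blocked, $4^{-j}$ if $p$ is empty, and otherwise the sum of the capacities of its four children; $\mathrm{cap}(T)$ is the capacity of the root. A move takes a $j$-square assigned to a $j$-pixel $p$ and reassigns it to a $j$-pixel $q$ that is empty before the move; moves are performed one at a time. *)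

(* Defs.v *)
From mathcomp Require Import all_boot all_order all_algebra.
From Stdlib Require Import Relation_Operators.

Set Implicit Arguments.
Unset Strict Implicit.
Unset Printing Implicit Defensive.

Import Order.TTheory GRing.Theory Num.Theory.
Local Open Scope ring_scope.

(* A pixel is given by the path leading to it from the root [0,1]^2, which is  *)
(* the empty path: each letter selects one of the four quadrants (right half?, *)
(* upper half?) of the square reached so far.  The j-pixels are the paths of   *)
(* length j, and q lies in the subtree of p when p is a prefix of q.           *)
Definition quadrant : Type := (bool * bool)%type.
Definition pixel : Type := seq quadrant.

Definition layer (p : pixel) : nat := size p.
Definition child (p : pixel) (d : quadrant) : pixel := rcons p d.
Definition proper_descendant (q p : pixel) : bool := prefix p q && (q != p).

(* S is the finite set of squares, s : S being an (rk s)-square.  Squares of   *)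
(* equal side remain distinguishable.                                          *)
Record config (S : finType) (rk : S -> nat) : Type := Config {
  assign :> S -> pixel;
  assign_layer : forall s, layer (assign s) = rk s;
  assign_inj : injective assign;
  assign_antichain :
    forall s t, ~~ proper_descendant (assign s) (assign t)
}.

Section Quadtree.

Variables (S : finType) (rk : S -> nat).
Implicit Types (T : config rk) (p q : pixel).

Definition contains_square T p : bool :=
  [exists s, (T s == p) || proper_descendant (T s) p].

Definition occupied T p : bool := [exists s, T s == p].

Definition blocked T p : bool :=
  ~~ occupied T p && [exists s, proper_descendant p (T s)].

Definition free_pixel T p : bool := ~~ occupied T p && ~~ blocked T p.

Definition empty T p : bool := free_pixel T p && ~~ contains_square T p.

(* The recursion defining the capacity descends only through pixels having a   *)
(* square strictly below them, so the largest layer of a square bounds its     *)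
(* depth; capE below is the recursion without the fuel n.                      *)
Fixpoint cap_rec T (n : nat) p : rat :=
  if occupied T p || blocked T p then 0
  else if empty T p then 4 ^- layer p
  else if n is n'.+1 then \sum_(d : quadrant) cap_rec T n' (child p d)
  else 0.

Definition cap T p : rat := cap_rec T (\max_(s : S) rk s - layer p)%N p.

Definition cap_config T : rat := cap T [::].

Lemma capE T p :
  cap T p = if occupied T p || blocked T p then 0
            else if empty T p then 4 ^- layer p
            else \sum_(d : quadrant) cap T (child p d).
Proof.
rewrite /cap; case def_n: (_ - layer p)%N => [|n] /=; last first.
  case: ifP => // _; case: ifP => // _; apply: eq_bigr => d _.
  by rewrite /layer size_rcons subnS -/(layer p) def_n.
case: ifP => // /negbT; rewrite negb_or => /andP[occF blkF].
case: ifP => // /negbT; rewrite /empty /free_pixel occF blkF /= negbK.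
case/existsP=> s; have sNp: T s != p by apply: contra occF => Ts; apply/existsP; exists s.
rewrite (negPf sNp) /= => /andP[/prefixP[u Ts] _].
have : (layer p < rk s)%N.
  rewrite -(assign_layer T) /layer Ts size_cat -[ltnLHS]addn0 ltn_add2l lt0n size_eq0.
  by apply: contra sNp => /eqP u0; rewrite Ts u0 cats0.
move/eqP: def_n; rewrite subn_eq0 => le_p.
by rewrite ltnNge (leq_trans (leq_bigmax s) le_p).
Qed.

(* Since q is empty, the reassignment always satisfies the axioms of config, so *)
(* requiring T' : config rk excludes no move.                                  *)
Definition move T T' : Prop :=
  exists (s : S) (q : pixel),
    [/\ layer q = layer (T s), empty T q
      & forall t, T' t = if t == s then q else T t].

Definition reachable : config rk -> config rk -> Prop := clos_refl_trans _ move.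

End Quadtree.

(* Main.v *)
(** For large [N] every [N]-pixel is occupied, blocked or empty, so the capacity
    is [4^-N] times the number of empty [N]-pixels; the hypothesis thus provides
    [4^(N-j)] empty [N]-pixels.  It remains to trade [4 * m] empty pixels of
    layer [n+1] for [m] empty pixels of layer [n].  As long as fewer than [m]
    [n]-pixels are empty, some empty [(n+1)]-pixel has a non-empty parent [p].
    By counting, while [p] is non-empty there is an empty [(n+1)]-pixel that
    lies neither in [p] nor in an empty [n]-pixel; a non-empty child of [p]
    is relocated there as a whole, which does not decrease the number of empty
    [(n+1)]-pixels, and this repeats until [p] is empty. *)
Require Import Defs.
From mathcomp Require Import all_boot all_order all_algebra.
From Stdlib Require Import Relation_Operators.

Set Implicit Arguments.
Unset Strict Implicit.

Import Order.TTheory GRing.Theory Num.Theory.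
Local Open Scope ring_scope.

(** * Pixel status in terms of the prefix order on paths *)

Lemma prefix_comparable (A : eqType) (s t u : seq A) :
  prefix s u -> prefix t u -> prefix s t || prefix t s.
Proof.
elim: u s t => [|a u IHu] [|b s] [|c t] //=.
by move=> /andP[/eqP<- su] /andP[/eqP<- tu]; rewrite eqxx /= IHu.
Qed.

Lemma prefix_same_size (A : eqType) (s t : seq A) :
  size s = size t -> prefix s t -> s = t.
Proof. by move=> st; rewrite prefixE st take_size => /eqP. Qed.

Section Config.

Variables (S : finType) (rk : S -> nat).
Implicit Types (T : config rk) (p q x : pixel).

Lemma occupied_or_blockedE T p :
  occupied T p || blocked T p = [exists s, prefix (T s) p].
Proof.
apply/orP/existsP => [|[s sp]].
  case=> [/existsP[s /eqP<-]|/andP[_ /existsP[s /andP[sp _]]]]; exists s => //.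
  exact: prefix_refl.
have [occ|nocc] := boolP (occupied T p); first by left.
right; rewrite /blocked nocc; apply/existsP; exists s.
rewrite /proper_descendant sp; apply: contra nocc => /eqP ->.
by apply/existsP; exists s.
Qed.

Lemma free_pixelP T p :
  reflect (forall s, ~~ prefix (T s) p) (free_pixel T p).
Proof.
rewrite /free_pixel -negb_or occupied_or_blockedE negb_exists.
exact: forallP.
Qed.

(** Emptiness amounts to incomparability with every assigned pixel; all later arguments use it in
    this form. *)
Lemma emptyP T p :
  reflect (forall s, ~~ prefix (T s) p /\ ~~ prefix p (T s)) (empty T p).
Proof.
have descE s : (T s == p) || proper_descendant (T s) p = prefix p (T s).
  by rewrite /proper_descendant; case: eqP => [->|_]; rewrite ?prefix_refl ?andbT.
apply: (iffP andP) => [[/free_pixelP fp ncp] s|ep]; split.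
- exact: fp.
- by rewrite -descE; apply: contra ncp => ?; apply/existsP; exists s.
- by apply/free_pixelP => s; case: (ep s).
- by apply/existsPn => s; rewrite descE; case: (ep s).
Qed.

(** Combines the antichain condition with injectivity, so that a prefix test alone identifies
    squares. *)
Lemma assign_prefix T s t : prefix (T s) (T t) -> s = t.
Proof.
move=> st; apply: (@assign_inj _ _ T); apply/esym/eqP.
by have:= assign_antichain T t s; rewrite /proper_descendant st /= negbK.
Qed.

Lemma empty_prefix T p q : prefix p q -> empty T p -> empty T q.
Proof.
move=> pq /emptyP ep; apply/emptyP => s; have [np nq] := ep s; split.
  by apply/negP => sq; have /orP[] := prefix_comparable sq pq; apply/negP.
by apply: contra nq; apply: prefix_trans.
Qed.

Lemma free_prefix T p q : prefix p q -> free_pixel T q -> free_pixel T p.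
Proof.
move=> pq /free_pixelP fq; apply/free_pixelP => s.
by apply: contra (fq s) => sp; apply: prefix_trans pq.
Qed.

(** * Moves and the relocation of whole subtrees *)

Lemma move_exists T s q :
  layer q = layer (T s) -> empty T q ->
  exists T' : config rk,
    move T T' /\ forall t, T' t = if t == s then q else T t.
Proof.
move=> sz_q /[dup] eq_q /emptyP eq.
pose f t := if t == s then q else T t.
have f_layer t : layer (f t) = rk t.
  by rewrite /f; case: eqP => [->|_]; rewrite ?sz_q assign_layer.
have f_prefix t u : prefix (f t) (f u) -> t = u.
  rewrite /f; case: eqP => [->|_]; case: eqP => [->|_] //.
  - by have [_ /negP] := eq u.
  - by have [/negP] := eq t.
  exact: assign_prefix.
have f_inj : injective f.
  by move=> t u ftu; apply: f_prefix; rewrite ftu prefix_refl.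
have f_anti t u : ~~ proper_descendant (f t) (f u).
  by apply/negP => /andP[/f_prefix->]; rewrite eqxx.
by exists (Config f_layer f_inj f_anti); split=> //; exists s, q; split.
Qed.

(** Induction on the number of squares in [p], moving one at a time. The hypothesis speaks of the
    targets and not of [q], because [q] ceases to be empty after the first move while the remaining
    targets stay empty. *)
Lemma relocate T p q :
  size p = size q -> p != q ->
  (forall s, prefix p (T s) -> empty T (q ++ drop (size p) (T s))) ->
  exists T' : config rk, reachable T T' /\
    forall s, T' s = if prefix p (T s) then q ++ drop (size p) (T s) else T s.
Proof.
move=> sz_pq neq_pq.
have not_p u : prefix p (q ++ u) = false.
  by rewrite prefixE sz_pq take_size_cat // eq_sym (negPf neq_pq).
have [n le_n] := ubnP #|[set s | prefix p (T s)]|.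
elim: n T le_n => // n IHn T; rewrite ltnS => le_n e_q.
have [/existsP[s ps]|/existsPn none] := boolP [exists s, prefix p (T s)]; last first.
  exists T; split=> [|s]; first exact: rt_refl.
  by rewrite (negPf (none s)).
have [u sE] := prefixP ps.
have sz_q : layer (q ++ drop (size p) (T s)) = layer (T s).
  by rewrite /layer sE drop_size_cat // !size_cat sz_pq.
have [T1 [mv T1E]] := move_exists sz_q (e_q _ ps).
have T1p t : prefix p (T1 t) = (t != s) && prefix p (T t).
  by rewrite T1E; case: eqP => //=; rewrite not_p.
have [||T' [r T'E]] := IHn T1.
- apply: leq_trans le_n; apply/proper_card/properP; split.
    by apply/subsetP => t; rewrite !inE T1p => /andP[].
  by exists s; rewrite inE ?T1p ?eqxx.
- move=> t; rewrite T1p T1E => /andP[ts pt]; rewrite (negPf ts).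
  have [v tE] := prefixP pt.
  (* Only the square [s] just moved is new. If its target and that of [t] were comparable, so would
     be their original pixels, as both paths only exchange the prefix [p] for [q]. *)
  apply/emptyP => w; rewrite T1E; case: eqP => [_|_]; last exact/emptyP/e_q.
  rewrite sE tE !drop_size_cat // !prefix_catr // eqxx /=.
  split; apply/negP => uv.
    by rewrite (@assign_prefix T s t) ?eqxx // in ts; rewrite sE tE prefix_catr // eqxx.
  by rewrite (@assign_prefix T t s) ?eqxx // in ts; rewrite sE tE prefix_catr // eqxx.
exists T'; split=> [|t]; first by apply: rt_trans r; apply: rt_step.
by rewrite T'E T1p T1E; case: eqP => [->|]//=; rewrite ps.
Qed.

(** Squares arrive only inside [q], so emptiness can be lost only at pixels comparable to [q], and
    freeness only inside [q]. The last hypothesis excludes squares strictly above [p], which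
    relocation would leave in place. *)
Lemma relocate_empty T p q :
    size p = size q -> empty T q -> ~~ empty T p ->
    (forall s, prefix (T s) p -> T s = p) ->
  exists T' : config rk, [/\ reachable T T', empty T' p,
    forall x, empty T x -> ~~ prefix x q -> ~~ prefix q x -> empty T' x
    & forall x, free_pixel T x -> ~~ prefix q x -> free_pixel T' x].
Proof.
move=> sz_pq e_q ne_p top_p.
have neq_pq : p != q by apply: contraNneq ne_p => ->.
have not_p u : prefix p (q ++ u) = false.
  by rewrite prefixE sz_pq take_size_cat // eq_sym (negPf neq_pq).
have [s _|T' [r T'E]] := @relocate T p q sz_pq neq_pq.
  by apply: empty_prefix e_q; apply: prefix_prefix.
exists T'; split=> //.
- apply/emptyP => s; rewrite T'E; case: ifP => [_|nps]; rewrite ?not_p ?nps.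
    split=> //; apply: contra neq_pq => qp.
    rewrite eq_sym; apply/eqP/(prefix_same_size (esym sz_pq)).
    by apply: prefix_trans qp; apply: prefix_prefix.
  split=> //; apply/negP => sp; move: nps.
  by rewrite (top_p _ sp) prefix_refl.
- move=> x /emptyP e_x nxq nqx; apply/emptyP => s; rewrite T'E; case: ifP => // _.
  split; first by apply: contra nqx; apply: prefix_trans; apply: prefix_prefix.
  apply/negP => xq; have := prefix_comparable xq (prefix_prefix q _).
  by rewrite (negPf nxq) (negPf nqx).
move=> x /free_pixelP f_x nqx; apply/free_pixelP => s; rewrite T'E.
case: ifP => // _; apply: contra nqx; apply: prefix_trans; exact: prefix_prefix.
Qed.

(** * Trading empty pixels of one layer for empty pixels of the layer above *)

Definition empties T n : {set n.-tuple quadrant} :=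
  [set x : n.-tuple quadrant | empty T x].

Definition children n (A : {set n.-tuple quadrant}) : {set n.+1.-tuple quadrant} :=
  [set rcons_tuple x d | x in A, d in [set: quadrant]].

Lemma mem_children n (A : {set n.-tuple quadrant}) (x : n.-tuple quadrant)
    (y : n.+1.-tuple quadrant) :
  x \in A -> prefix x y -> y \in children A.
Proof.
move=> xA /prefixP[[|d [|d' u]] yE].
- by have := size_tuple y; rewrite yE cats0 size_tuple => /n_Sn.
- by apply/imset2P; exists x d; rewrite ?inE //; apply: val_inj; rewrite /= yE cats1.
- by have := size_tuple y; rewrite yE size_cat size_tuple /= !addnS => -[/eqP]; rewrite -addnS -[eqbRHS]addn0 eqn_add2l.
Qed.

Lemma card_children n (A : {set n.-tuple quadrant}) :
  (#|children A| <= 4 * #|A|)%N.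
Proof.
rewrite /children curry_imset2X; apply: leq_trans (leq_imset_card _ _) _.
by rewrite cardsX cardsT card_prod card_bool mulnC.
Qed.

(** [G] holds pixels already won, which must survive the emptying of [p]. Induction on the number of
    non-empty children of [p]; the count of empty pixels of layer [n.+1] never drops, so each round
    finds a target. *)
Lemma gather n (p : n.-tuple quadrant) (G : {set n.-tuple quadrant}) T :
    p \notin G -> free_pixel T p -> G \subset empties T n ->
    (4 * #|G|.+1 <= #|empties T n.+1|)%N ->
  exists T' : config rk, [/\ reachable T T', p |: G \subset empties T' n
    & (#|empties T n.+1| <= #|empties T' n.+1|)%N].
Proof.
move=> npG; have [k] := ubnP #|[set d | ~~ empty T (child p d)]|.
elim: k T => // k IHk T; rewrite ltnS => le_k f_p e_G ge_E.
have [e_p|ne_p] := boolP (empty T p).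
  by exists T; split=> //; [exact: rt_refl|rewrite subUset sub1set inE e_p].
have [d ne_d] : exists d, ~~ empty T (child p d).
  apply/existsP; apply: contraNT ne_p => /existsPn all_e; apply/emptyP => s.
  split; first exact/free_pixelP.
  apply/negP => /prefixP[[|d u] sE].
    by have/free_pixelP/(_ s)/negP[] := f_p; rewrite sE cats0 prefix_refl.
  have /emptyP/(_ s)[_ /negP[]] := negPn (all_e d).
  by rewrite sE /child -cat_rcons prefix_prefix.
(* There are at most [4 * #|G|.+1] children of [p |: G], and the child [d] of [p] is one that is not
   empty; so they cannot include all empty pixels. *)
have [q e_q nq] : exists2 q, q \in empties T n.+1 & q \notin children (p |: G).
  apply/subsetPn; apply/negP => sub; move: ge_E; rewrite leqNgt => /negP[].
  have -> : #|G|.+1 = #|p |: G| by rewrite cardsU1 npG.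
  apply: leq_trans (card_children _); apply/proper_card/properP; split=> //.
  exists (rcons_tuple p d); last by rewrite inE.
  by apply: (@mem_children _ _ p); rewrite ?setU11 //= prefix_rcons.
have not_below (x : n.-tuple quadrant) : x \in p |: G -> ~~ prefix x q.
  by move=> xG; apply: contra nq; apply: mem_children.
have not_above (x : n.-tuple quadrant) : ~~ prefix q x.
  by apply/negP => /size_prefix; rewrite !size_tuple ltnn.
have incomp (x : n.+1.-tuple quadrant) : x != q -> ~~ prefix x q /\ ~~ prefix q x.
  move=> xq; split; apply: contra xq => xq; apply/eqP/val_inj.
    by apply: prefix_same_size xq; rewrite !size_tuple.
  by apply/esym; apply: prefix_same_size xq; rewrite !size_tuple.
have sz_q : size (child p d) = size q by rewrite size_rcons !size_tuple.
have [||s|T1 [r e_d keep keep_f]] := @relocate_empty T (child p d) q sz_q => //.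
- by rewrite inE in e_q.
- case/prefixP=> u; case/lastP: u => [|u e]; rewrite ?cats0 // -rcons_cat.
  by case/rcons_inj=> pE _; have /negP[] := free_pixelP _ _ f_p s; rewrite pE prefix_prefix.
(* Only [q] can be lost from the count, and the child [d] of [p] is gained. *)
have le_E : (#|empties T n.+1| <= #|empties T1 n.+1|)%N.
  apply: (@leq_trans #|rcons_tuple p d |: empties T n.+1 :\ q|).
    by rewrite cardsU1 (cardsD1 q (empties T _)) e_q !inE negb_and ne_d orbT.
  apply/subset_leq_card/subsetP => x; rewrite !inE.
  by case/predU1P => [->//|/andP[/incomp[? ?] e_x]]; apply: keep.
have [||||T' [r' e_T' le_T']] := IHk T1.
(* The child [d] is now empty, and the empty children of [p] stay so because [q] is not among
   them. *)
- apply: leq_trans le_k; apply/proper_card/properP; split; last first.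
    by exists d; rewrite inE ?e_d.
  apply/subsetP => d'; rewrite !inE; apply: contra => e_d'.
  have [] := incomp (rcons_tuple p d').
    apply: contraNneq nq => <-; apply: (@mem_children _ _ p); rewrite ?setU11 //.
    exact: prefix_rcons.
  exact: keep.
- exact: keep_f.
- apply/subsetP => x xG; rewrite inE; apply: keep => //.
    by have := subsetP e_G _ xG; rewrite inE.
  by apply: not_below; rewrite setU1r.
- exact: leq_trans le_E.
exists T'; split=> //; first exact: rt_trans r'.
exact: leq_trans le_T'.
Qed.

Lemma coarsen n m T :
  (4 * m <= #|empties T n.+1|)%N ->
  exists T' : config rk, reachable T T' /\ (m <= #|empties T' n|)%N.
Proof.
move=> ge_E.
(* The bound [4 * m] is carried along as an invariant, so that [gather] applies again in every
   round. *)
suff /(_ m (leqnn m))[T' [r _ ge_m]] : forall k, (k <= m)%N -> exists T' : config rk,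
    [/\ reachable T T', 4 * m <= #|empties T' n.+1| & k <= #|empties T' n|]%N.
  by exists T'.
elim=> [|k IHk] lt_km.
  by exists T; split=> //; apply: rt_refl.
have [T1 [r ge_E1]] := IHk (ltnW lt_km).
rewrite leq_eqVlt => /predU1P[k_E|]; last by move=> ?; exists T1.
(* The [k] empty pixels of layer [n] have at most [4 * k < 4 * m] children, so some empty [q] has a
   non-empty parent. That parent is free because [q] is, and it is emptied next. *)
have [q e_q nq] : exists2 q, q \in empties T1 n.+1 & q \notin children (empties T1 n).
  apply/subsetPn; apply/negP => /subset_leq_card; rewrite leqNgt => /negP[].
  apply: leq_ltn_trans (card_children _) _; rewrite -k_E.
  by apply: leq_trans ge_E1; rewrite ltn_mul2l.
have sz_q : size (take n q) == n by rewrite size_takel // size_tuple.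
have pq : prefix (Tuple sz_q) q by apply: prefix_take.
have [||//||T' [r' e_T' le_E]] := @gather n (Tuple sz_q) (empties T1 n) T1.
- by apply: contra nq => ?; apply: mem_children pq.
- by apply: free_prefix pq _; move: e_q; rewrite inE => /andP[].
- by rewrite -k_E; apply: leq_trans ge_E1; rewrite leq_mul2l.
exists T'; split; [exact: rt_trans r' | exact: leq_trans le_E | ].
apply: leq_trans (subset_leq_card e_T').
rewrite cardsU1 -k_E -add1n leq_add2r lt0b.
by apply: contra nq => ?; apply: mem_children pq.
Qed.

(** * Capacity as a count of empty pixels on a deep layer *)

Lemma card_empties_child T n p :
  #|[set u : n.+1.-tuple quadrant | empty T (p ++ u)]| =
  (\sum_d #|[set u : n.-tuple quadrant | empty T (child p d ++ u)]|)%N.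
Proof.
rewrite -sum1dep_card (reindex (fun du : quadrant * n.-tuple quadrant => cons_tuple du.1 du.2)) /=.
  rewrite -(pair_big_dep xpredT (fun d (u : n.-tuple quadrant) => empty T (p ++ d :: u)) (fun _ _ => 1%N)) /=.
  by apply: eq_bigr => d _; rewrite sum1dep_card; apply: eq_card => u; rewrite !inE cat_rcons.
exists (fun x : n.+1.-tuple quadrant => (thead x, behead_tuple x)) => [[d u] _|x _] /=.
  by congr pair; apply: val_inj.
by rewrite [RHS]tuple_eta.
Qed.

(** Induction along [capE]: an empty pixel accounts for all its [4 ^ n] descendants of layer
    [size p + n], an occupied or blocked one for none. *)
Lemma cap_card T n p :
  (forall s, rk s <= size p + n)%N ->
  cap T p = 4 ^- (size p + n) * #|[set u : n.-tuple quadrant | empty T (p ++ u)]|%:R.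
Proof.
elim: n p => [|n IHn] p le_rk; rewrite capE occupied_or_blockedE.
all: case: ifPn => [/existsP[s sp]|/existsPn f_p]; [|case: ifPn => [e_p|ne_p]].
1, 4: rewrite (_ : finset _ = set0) ?cards0 ?mulr0 //.
1, 2: apply/setP => u; rewrite !inE; apply/negbTE/emptyP => /(_ s)[/negP[]].
1, 2: by apply: prefix_trans sp _; apply: prefix_prefix.
1, 3: rewrite (_ : finset _ = setT); last first.
1, 3: by apply/setP => u; rewrite !inE; apply: empty_prefix e_p; apply: prefix_prefix.
1, 2: rewrite cardsT card_tuple card_prod card_bool natrX exprD invfM -mulrA.
1, 2: by rewrite mulVf ?mulr1 // expf_neq0.
(* At depth zero a free pixel is empty: a square in its subtree has layer at most [size p], so it
   would sit at [p] itself. *)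
- case/negP: ne_p; apply/emptyP => s; split=> //; apply/negP => ps.
  have := f_p s; rewrite -(prefix_same_size _ ps) ?prefix_refl //.
  by apply/eqP; rewrite eqn_leq size_prefix // -[leqRHS]addn0 -/(layer (T s)) assign_layer le_rk.
rewrite card_empties_child natr_sum mulr_sumr; apply: eq_bigr => d _.
by rewrite IHn size_rcons addSnnS // addnS.
Qed.

End Config.

Theorem theorem1 (S : finType) (rk : S -> nat) (j : nat) (T : config rk) :
  4 ^- j <= cap_config T ->
  exists T' : config rk,
    reachable T T' /\ exists q : pixel, layer q = j /\ empty T' q.
Proof.
(* Layer [j + n] lies at or below layer [j] and the layer of every square. *)
pose n := (\max_(s : S) rk s)%N.
have le_rk s : (rk s <= size ([::] : pixel) + (j + n))%N.
  by rewrite /= add0n (leq_trans (leq_bigmax s)) // leq_addl.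
rewrite /cap_config (cap_card T le_rk) /= add0n.
rewrite ler_pdivlMl ?exprn_gt0 // exprD mulrAC mulfV ?expf_neq0 // mul1r.
rewrite -natrX ler_nat => ge_E.
have {ge_E} : (4 ^ n <= #|empties T (j + n)|)%N by [].
(* Each layer climbed costs a factor of four, so [4 ^ n] empty pixels [n] layers below [j] leave at
   least one of layer [j]. *)
elim: n {le_rk} T => [|n IHn] T; rewrite ?addn0 ?addnS.
  rewrite expn0 card_gt0 => /set0Pn[q]; rewrite inE => e_q.
  exists T; split; first exact: rt_refl.
  by exists q; rewrite /layer size_tuple.
rewrite expnS => /coarsen[T1 [r /IHn[T' [r' ?]]]].
by exists T'; split=> //; apply: rt_trans r'.
Qed.
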